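(* Let $K$ be an infinite field and $n,p,r$ positive integers. For generic vectors $u_1,\ldots,u_r\in K^n$, $v_1,\ldots,v_r\in K^n$, $w_1,\ldots,w_r\in K^p$, with $T=\sum_{i=1}^r u_i\otimes v_i\otimes w_i$ having slices $T_1,\ldots,T_p$: 1. If $r\geq n$, the slices $T_1,\ldots,T_p$ are all invertible. 2. If moreover $p\geq 4$ and $n\leq r\leq 4n/3$, then, letting $A_k=T_1^{-1}T_{k+1}$ for $k=1,\ldots,p-1$, for any triple of distinct integers $k,l,m\leq p-1$ we have $\mathrm{rank}[A_k,A_l]=2(r-n)$ and $\dim(\mathrm{Im}[A_k,A_l]+\mathrm{Im}[A_k,A_m])=3(r-n)$.
   Context: A property holds for generic $x\in K^N$ if there is a non-identically-zero polynomial $P\in K[x_1,\ldots,x_N]$ such that the property holds for all $x$ with $P(x)\neq0$; here $x$ is the $r(2n+p)$-tuple of coordinates of the $u_i,v_i,w_i$. $u\otimes v\otimes w$ has entries $u_iv_jw_k$; slices $T_k=(T_{ijk})_{i,j}$. $[X,Y]=XY-YX$; $\mathrm{Im}$ is column space. *)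

(* Defs.v *)
From mathcomp Require Import all_boot all_order all_algebra.
From mathcomp Require Import mpoly.

Set Implicit Arguments.
Unset Strict Implicit.
Unset Printing Implicit Defensive.

Import GRing.Theory.
Local Open Scope ring_scope.

Definition infinite_type (T : eqType) : Prop :=
  forall s : seq T, exists x : T, x \notin s.

Definition generic (K : fieldType) (N : nat) (Q : 'rV[K]_N -> Prop) : Prop :=
  exists P : {mpoly K[N]}, P != 0 /\ forall x : 'rV[K]_N, P.@[x 0] != 0 -> Q x.

Section Tensors.
Variables (K : fieldType) (n m p : nat).

Definition tensor := {ffun 'I_n * 'I_m * 'I_p -> K}.

Definition otimes (u : 'rV[K]_n) (v : 'rV[K]_m) (w : 'rV[K]_p) : tensor :=
  [ffun t : 'I_n * 'I_m * 'I_p => u 0 t.1.1 * v 0 t.1.2 * w 0 t.2].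

Definition slice (T : tensor) (k : 'I_p) : 'M[K]_(n, m) :=
  \matrix_(i < n, j < m) T (i, j, k).

End Tensors.

(* A point of K^(r(2n+p)) is read as an r x (n+n+p) array whose i-th row is the
   concatenation of u_i, v_i and w_i. *)
Section Coordinates.
Variables (K : fieldType) (n p r : nat) (x : 'rV[K]_(r * (n + n + p))).

Definition uvec (i : 'I_r) : 'rV[K]_n := row i (lsubmx (lsubmx (vec_mx x))).
Definition vvec (i : 'I_r) : 'rV[K]_n := row i (rsubmx (lsubmx (vec_mx x))).
Definition wvec (i : 'I_r) : 'rV[K]_p := row i (rsubmx (vec_mx x)).

End Coordinates.

Definition mxbracket (K : fieldType) (n : nat) (X Y : 'M[K]_n) : 'M[K]_n :=
  X *m Y - Y *m X.

(* Subspaces are represented by row spaces, so the column space of X is the row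
   space of X^T; its dimension is \rank and sums of subspaces are taken in %MS. *)
Definition colspace (K : fieldType) (m n : nat) (X : 'M[K]_(m, n)) : 'M[K]_m :=
  <<X^T>>%MS.

(* Main.v *)
(** Write T_k = U^T D_k V with D_k diagonal. When T_1 and D_1 are invertible,
    A_k = L E_k V with E_k = D_1^-1 D_k, L = T_1^-1 U^T D_1 and L V = 1, so the
    A_k are compressions of commuting matrices. The projector 1 - V L has rank
    r - n and factors as X Y, whence
      [A_k, A_l] = (L E_l X) (Y E_k V) - (L E_k X) (Y E_l V),
    which bounds both ranks from above. Lower bounds on the rank of a polynomial
    matrix are open conditions, so for these one point suffices: with e_1, e_2,
    e_3 orthonormal n x (r - n) frames and B = e_1 + e_2 + e_3, the matrices
    T_1 = 1, A_k = B B^T, A_l = e_2 e_2^T, A_m = e_3 e_3^T do. Denominators are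
    avoided by replacing T_1^-1 with the adjugate of T_1. *)

Require Import Defs.
From mathcomp Require Import all_boot all_order all_algebra.
From mathcomp Require Import mpoly zify.

Set Implicit Arguments.
Unset Strict Implicit.
Unset Printing Implicit Defensive.

Import GRing.Theory.
Local Open Scope ring_scope.

(** * Closure properties of generic conditions *)

Lemma generic_sub (K : fieldType) (N : nat) (Q R : 'rV[K]_N -> Prop) :
  (forall x, Q x -> R x) -> generic Q -> generic R.
Proof. by move=> QR [P [P0 PQ]]; exists P; split=> // x /PQ/QR. Qed.

Lemma generic_true (K : fieldType) (N : nat) (Q : 'rV[K]_N -> Prop) :
  (forall x, Q x) -> generic Q.
Proof. by move=> QT; exists 1; split=> //; exact: oner_neq0. Qed.

(** The product of the two polynomials serves, being nonzero because [{mpoly K[N]}] is an integral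
    domain. *)
Lemma generic_and (K : fieldType) (N : nat) (Q R : 'rV[K]_N -> Prop) :
  generic Q -> generic R -> generic (fun x => Q x /\ R x).
Proof.
move=> [P [P0 PQ]] [P' [P'0 PR]]; exists (P * P'); split; first exact: mulf_neq0.
by move=> x; rewrite mevalM mulf_eq0 negb_or => /andP[/PQ ? /PR].
Qed.

Lemma generic_all (K : fieldType) (N : nat) (I : finType)
    (Q : I -> 'rV[K]_N -> Prop) :
  (forall i, generic (Q i)) -> generic (fun x => forall i, Q i x).
Proof.
move=> genQ.
suff : generic (fun x => forall i, i \in enum I -> Q i x).
  by apply: generic_sub => x QT i; apply: QT; rewrite mem_enum.
elim: (enum I) => [|i s IHs]; first exact: generic_true.
apply: generic_sub (generic_and (genQ i) IHs) => x [Qi Qs] j.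
by rewrite inE => /predU1P[->|/Qs].
Qed.

Lemma generic_imply (K : fieldType) (N : nat) (b : bool) (Q : 'rV[K]_N -> Prop) :
  (b -> generic Q) -> generic (fun x => b -> Q x).
Proof.
by case: b => [/(_ isT)|_]; [apply: generic_sub | apply: generic_true].
Qed.

(** * Matrices with polynomial entries in the coordinates of a point *)

Definition polymx (K : fieldType) (N a b : nat) (F : 'rV[K]_N -> 'M[K]_(a, b)) :=
  exists M : 'M[{mpoly K[N]}]_(a, b), forall x, F x = map_mx (meval (x 0)) M.

Section PolyMx.
Variables (K : fieldType) (N : nat).

Lemma polymx_const a b (C : 'M[K]_(a, b)) : polymx (fun _ : 'rV[K]_N => C).
Proof.
exists (map_mx (@mpolyC N K) C) => x.
by apply/matrixP => i j; rewrite !mxE mevalC.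
Qed.

Lemma polymx_id : polymx (fun x : 'rV[K]_N => x).
Proof.
exists (\row_i 'X_i) => x.
by apply/matrixP => i j; rewrite !mxE ord1 mevalXU.
Qed.

Lemma polymx_mul a b c (F : 'rV[K]_N -> 'M[K]_(a, b)) (G : 'rV[K]_N -> 'M[K]_(b, c)) :
  polymx F -> polymx G -> polymx (fun x => F x *m G x).
Proof.
by move=> [M FM] [L GL]; exists (M *m L) => x; rewrite FM GL map_mxM.
Qed.

Lemma polymx_sub a b (F G : 'rV[K]_N -> 'M[K]_(a, b)) :
  polymx F -> polymx G -> polymx (fun x => F x - G x).
Proof.
by move=> [M FM] [L GL]; exists (M - L) => x; rewrite FM GL map_mxB.
Qed.

Lemma polymx_row a b c (F : 'rV[K]_N -> 'M[K]_(a, b)) (G : 'rV[K]_N -> 'M[K]_(a, c)) :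
  polymx F -> polymx G -> polymx (fun x => row_mx (F x) (G x)).
Proof.
by move=> [M FM] [L GL]; exists (row_mx M L) => x; rewrite FM GL map_row_mx.
Qed.

Lemma polymx_tr a b (F : 'rV[K]_N -> 'M[K]_(a, b)) :
  polymx F -> polymx (fun x => (F x)^T).
Proof. by move=> [M FM]; exists M^T => x; rewrite FM map_trmx. Qed.

Lemma polymx_col a b (F : 'rV[K]_N -> 'M[K]_(a, b)) k :
  polymx F -> polymx (fun x => col k (F x)).
Proof. by move=> [M FM]; exists (col k M) => x; rewrite FM map_col. Qed.

Lemma polymx_diag a (F : 'rV[K]_N -> 'rV[K]_a) :
  polymx F -> polymx (fun x => diag_mx (F x)).
Proof. by move=> [M FM]; exists (diag_mx M) => x; rewrite FM map_diag_mx. Qed.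

Lemma polymx_adj a (F : 'rV[K]_N -> 'M[K]_a) :
  polymx F -> polymx (fun x => \adj (F x)).
Proof. by move=> [M FM]; exists (\adj M) => x; rewrite FM map_mx_adj. Qed.

Lemma polymx_lsubmx a b c (F : 'rV[K]_N -> 'M[K]_(a, b + c)) :
  polymx F -> polymx (fun x => lsubmx (F x)).
Proof. by move=> [M FM]; exists (lsubmx M) => x; rewrite FM map_lsubmx. Qed.

Lemma polymx_rsubmx a b c (F : 'rV[K]_N -> 'M[K]_(a, b + c)) :
  polymx F -> polymx (fun x => rsubmx (F x)).
Proof. by move=> [M FM]; exists (rsubmx M) => x; rewrite FM map_rsubmx. Qed.

Lemma polymx_vec_mx a b (F : 'rV[K]_N -> 'rV[K]_(a * b)) :
  polymx F -> polymx (fun x => vec_mx (F x)).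
Proof. by move=> [M FM]; exists (vec_mx M) => x; rewrite FM map_vec_mx. Qed.

Lemma polymx_bracket a (F G : 'rV[K]_N -> 'M[K]_a) :
  polymx F -> polymx G -> polymx (fun x => mxbracket (F x) (G x)).
Proof. by move=> pF pG; apply: polymx_sub; apply: polymx_mul. Qed.

End PolyMx.

(** * Lower semicontinuity of the rank *)

Lemma mul_compress_scalar (K : fieldType) (a b d : nat) (M : 'M[K]_(a, b)) :
  (d <= \rank M)%N ->
  exists (B : 'M[K]_(d, a)) (C : 'M[K]_(b, d)), B *m M *m C = 1%:M.
Proof.
move=> dM; have da := leq_trans dM (rank_leq_row M).
have db := leq_trans dM (rank_leq_col M).
exists (pid_mx d *m invmx (col_ebase M)), (invmx (row_ebase M) *m pid_mx d).
rewrite -{2}(mulmx_ebase M) !mulmxA mulmxKV ?col_ebase_unit //.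
rewrite mulmxK ?row_ebase_unit // !mul_pid_mx -pid_mx_1; congr pid_mx; lia.
Qed.

Lemma rank_ge_of_mul1 (K : fieldType) (a b d : nat) (M : 'M[K]_(a, b))
    (B : 'M[K]_(d, a)) (C : 'M[K]_(b, d)) :
  B *m M *m C \in unitmx -> (d <= \rank M)%N.
Proof.
move=> /mxrank_unit {1}<-.
exact: leq_trans (mxrankM_maxl _ _) (mxrankM_maxr _ _).
Qed.

(** Choose constant [B] and [C] compressing [F x0] to the identity of size [d]. Then det (B F(x) C)
    is a polynomial in x with value 1 at [x0], hence nonzero, and wherever it does not vanish the
    rank is at least [d]. *)
Lemma generic_rank (K : fieldType) (N a b d : nat)
    (F : 'rV[K]_N -> 'M[K]_(a, b)) (x0 : 'rV[K]_N) :
  polymx F -> (d <= \rank (F x0))%N -> generic (fun x => (d <= \rank (F x))%N).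
Proof.
move=> pF /mul_compress_scalar[B [C BFC]].
have [M FM] : polymx (fun x => B *m F x *m C).
  by apply: polymx_mul; [apply: polymx_mul|]; do ?exact: polymx_const.
have detM (x : 'rV[K]_N) : (\det M).@[x 0] = \det (B *m F x *m C) by rewrite FM det_map_mx.
exists (\det M); split.
  apply: contra_eq_neq (detM x0) => ->.
  by rewrite meval0 BFC det1 eq_sym oner_neq0.
move=> x; rewrite detM -unitfE -unitmxE; exact: rank_ge_of_mul1.
Qed.

(** * Slices in the factored form U^T D_k V, and their dependence on the coordinates *)

Section TensorSlices.
Variables (K : fieldType) (n p r : nat).
Implicit Types (x : 'rV[K]_(r * (n + n + p))) (U V : 'M[K]_(r, n)) (W : 'M[K]_(r, p)).

Definition slice_of U V W (k : 'I_p) : 'M[K]_n :=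
  U^T *m diag_mx (col k W)^T *m V.

Definition umx x : 'M[K]_(r, n) := lsubmx (lsubmx (vec_mx x)).
Definition vmx x : 'M[K]_(r, n) := rsubmx (lsubmx (vec_mx x)).
Definition wmx x : 'M[K]_(r, p) := rsubmx (vec_mx x).

Definition coords U V W : 'rV[K]_(r * (n + n + p)) :=
  mxvec (row_mx (row_mx U V) W).

Lemma coordsK U V W : [/\ umx (coords U V W) = U, vmx (coords U V W) = V
  & wmx (coords U V W) = W].
Proof. by rewrite /umx /vmx /wmx mxvecK !row_mxKl !row_mxKr. Qed.

Lemma slice_sum_otimes x k :
  slice (\sum_(i < r) otimes (uvec x i) (vvec x i) (wvec x i)) k =
  slice_of (umx x) (vmx x) (wmx x) k.
Proof.
apply/matrixP => i j; rewrite !mxE sum_ffunE; apply: eq_bigr => c _.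
by rewrite mul_mx_diag !ffunE !mxE /= mulrAC.
Qed.

Lemma polymx_wdiag k : polymx (fun x => diag_mx (col k (wmx x))^T).
Proof.
apply/polymx_diag/polymx_tr/polymx_col/polymx_rsubmx/polymx_vec_mx.
exact: polymx_id.
Qed.

Lemma polymx_slice_of k : polymx (fun x => slice_of (umx x) (vmx x) (wmx x) k).
Proof.
have pUV : polymx (fun x => lsubmx (vec_mx x)).
  exact/polymx_lsubmx/polymx_vec_mx/polymx_id.
apply: polymx_mul; last exact: polymx_rsubmx pUV.
apply: polymx_mul (polymx_wdiag k).
exact/polymx_tr/polymx_lsubmx.
Qed.

End TensorSlices.

(** * Commutators of compressions of commuting matrices: upper bounds *)

Section Compression.
Variables (K : fieldType) (n r : nat) (L : 'M[K]_(n, r)) (V : 'M[K]_(r, n)).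
Hypothesis LV : L *m V = 1%:M.

Let Q := 1%:M - V *m L.
Let X := col_base Q.
Let Y := row_base Q.

(** Since L V = 1, the matrix [V] has rank n and Q V = 0, so rank Q + n is at most r. *)
Lemma rank_compl_proj : (\rank Q <= r - n)%N.
Proof.
have QV : Q *m V = 0 by rewrite mulmxBl mul1mx -mulmxA LV mulmx1 subrr.
have rV : (n <= \rank V)%N by rewrite -{1}(mxrank1 K n) -LV mxrankM_maxr.
have := mulmx0_rank_max QV; lia.
Qed.

(** Substitute V L = 1 - X Y in the middle of each product. The terms L E F V and L F E V cancel by
    commutation, and only those passing through X Y survive. *)
Lemma bracket_compression (E F : 'M[K]_r) : comm_mx E F ->
  mxbracket (L *m E *m V) (L *m F *m V) =
  row_mx (L *m F *m X) (L *m E *m X) *m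
  col_mx (Y *m E *m V) (- (Y *m F *m V)).
Proof.
have prod (G H : 'M[K]_r) : L *m G *m V *m (L *m H *m V) =
    L *m G *m H *m V - L *m G *m X *m (Y *m H *m V).
  have -> : L *m G *m X *m (Y *m H *m V) = L *m G *m Q *m H *m V.
    by rewrite -[in RHS](mulmx_base Q) !mulmxA.
  by rewrite mulmxBr mulmx1 !mulmxBl !mulmxA opprB addrC subrK.
move=> EF; rewrite /mxbracket !prod mul_row_col mulmxN.
by rewrite -[L *m E *m F]mulmxA EF mulmxA opprB addrC addrA subrK.
Qed.

Lemma rank_bracket_compression (E F : 'M[K]_r) : comm_mx E F ->
  (\rank (mxbracket (L *m E *m V) (L *m F *m V)) <= 2 * (r - n))%N.
Proof.
move=> /bracket_compression ->.
apply: leq_trans (mxrankM_maxl _ _) _; apply: leq_trans (rank_leq_col _) _.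
have := rank_compl_proj; lia.
Qed.

(** Both brackets have the block L E X in their left factor, so three blocks of width rank Q, rather
    than four, span the two column spaces. *)
Lemma rank_brackets_compression (E F G : 'M[K]_r) : comm_mx E F -> comm_mx E G ->
  (\rank (colspace (mxbracket (L *m E *m V) (L *m F *m V)) +
          colspace (mxbracket (L *m E *m V) (L *m G *m V)))%MS <= 3 * (r - n))%N.
Proof.
move=> /bracket_compression -> /bracket_compression ->.
set B := row_mx (L *m E *m X) (row_mx (L *m F *m X) (L *m G *m X)).
suff : (colspace (row_mx (L *m F *m X) (L *m E *m X) *m
                    col_mx (Y *m E *m V) (- (Y *m F *m V))) +
        colspace (row_mx (L *m G *m X) (L *m E *m X) *m
                    col_mx (Y *m E *m V) (- (Y *m G *m V))) <= B^T)%MS.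
  move/mxrankS/leq_trans; apply; apply: leq_trans (rank_leq_row _) _.
  have := rank_compl_proj; lia.
rewrite addsmx_sub !genmxE !trmx_mul !tr_row_mx.
have sub1 m1 m2 (G1 : 'M[K]_(m1, n)) (G2 : 'M[K]_(m2, n)) :
    (G1 <= col_mx G1 G2)%MS by rewrite -addsmxE addsmxSl.
have sub2 m1 m2 (G1 : 'M[K]_(m1, n)) (G2 : 'M[K]_(m2, n)) :
    (G2 <= col_mx G1 G2)%MS by rewrite -addsmxE addsmxSr.
apply/andP; split; apply: submx_trans (submxMl _ _) _;
  rewrite col_mx_sub sub1 andbT; apply: submx_trans (sub2 _ _ _ _); first exact: sub1.
exact: sub2.
Qed.

End Compression.

(** * A configuration attaining the lower bounds *)

Section Witness.
Variables (K : fieldType) (n s : nat) (e1 e2 e3 : 'M[K]_(n, s)).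
Hypotheses (e11 : e1^T *m e1 = 1%:M) (e12 : e1^T *m e2 = 0) (e13 : e1^T *m e3 = 0)
  (e21 : e2^T *m e1 = 0) (e22 : e2^T *m e2 = 1%:M) (e23 : e2^T *m e3 = 0)
  (e31 : e3^T *m e1 = 0) (e32 : e3^T *m e2 = 0) (e33 : e3^T *m e3 = 1%:M).

Let B := e1 + e2 + e3.
Let M := mxbracket (B *m B^T) (e2 *m e2^T).
Let N := mxbracket (B *m B^T) (e3 *m e3^T).

Let orthoE := (e11, e12, e13, e21, e22, e23, e31, e32, e33).

Let BTe2 : B^T *m e2 = 1%:M.
Proof. by rewrite !linearD /= !mulmxDl !orthoE add0r addr0. Qed.
Let BTe3 : B^T *m e3 = 1%:M.
Proof. by rewrite !linearD /= !mulmxDl !orthoE !add0r. Qed.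
Let BTe1 : B^T *m e1 = 1%:M.
Proof. by rewrite !linearD /= !mulmxDl !orthoE !addr0. Qed.
Let e2TB : e2^T *m B = 1%:M.
Proof. by rewrite !mulmxDr !orthoE add0r addr0. Qed.
Let e3TB : e3^T *m B = 1%:M.
Proof. by rewrite !mulmxDr !orthoE !add0r. Qed.

Let ME : M = B *m e2^T - e2 *m B^T.
Proof.
rewrite /M /mxbracket -!mulmxA (mulmxA B^T) BTe2 mul1mx.
by rewrite (mulmxA e2^T) e2TB mul1mx.
Qed.
Let NE : N = B *m e3^T - e3 *m B^T.
Proof.
rewrite /N /mxbracket -!mulmxA (mulmxA B^T) BTe3 mul1mx.
by rewrite (mulmxA e3^T) e3TB mul1mx.
Qed.

Let Me1 : M *m e1 = - e2.
Proof. by rewrite ME mulmxBl -!mulmxA e21 BTe1 mulmx0 mulmx1 sub0r. Qed.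
Let Me2 : M *m e2 = e1 + e3.
Proof.
by rewrite ME mulmxBl -!mulmxA e22 BTe2 !mulmx1 /B (addrAC e1) addrK.
Qed.
Let Ne1 : N *m e1 = - e3.
Proof. by rewrite NE mulmxBl -!mulmxA e31 BTe1 mulmx0 mulmx1 sub0r. Qed.

(** [M] sends e_1 to -e_2 and e_2 to e_1 + e_3; pairing these images with -e_2 and e_1 gives the
    identity of size 2s. *)
Lemma rank_witness_bracket : (2 * s <= \rank M)%N.
Proof.
have := @rank_ge_of_mul1 K n n (s + s) M (col_mx (- e2^T) e1^T) (row_mx e1 e2).
rewrite -mulmxA mul_mx_row Me1 Me2 mul_col_row !(mulNmx, mulmxN, mulmxDr) !orthoE.
rewrite opprK !addr0 oppr0 -scalar_mx_block unitmx1 mul2n -addnn; exact.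
Qed.

Lemma rank_witness_brackets : (3 * s <= \rank (row_mx M N))%N.
Proof.
(* The three block columns of [C] encode M e_2 + N e_1 = e_1, -M e_1 = e_2 and -N e_1 = e_3, so the
   joint image contains all three frames. *)
pose C := row_mx (col_mx e2 e1) (row_mx (col_mx (- e1) 0) (col_mx 0 (- e1))).
suff : (s + (s + s) <= \rank (row_mx M N))%N by rewrite !mulSn mul0n addn0.
apply: (@rank_ge_of_mul1 _ _ _ _ _ (col_mx e1^T (col_mx e2^T e3^T)) C).
rewrite -mulmxA.
have -> : row_mx M N *m C = row_mx e1 (row_mx e2 e3).
  rewrite !mul_mx_row !mul_row_col !mulmxN Me1 Me2 Ne1.
  by rewrite !mulmx0 !opprK addrK addr0 add0r.
rewrite mul_col_row mul_col_row mul_mx_row mul_col_mx !orthoE row_mx0 col_mx0.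
by rewrite -!scalar_mx_block unitmx1.
Qed.

End Witness.

(** The frames are disjoint blocks of standard basis vectors. This makes e_2 e_2^T and e_3 e_3^T
    diagonal, as needed to realize them as slices. *)
Lemma exists_three_frames (K : fieldType) (n s : nat) : (3 * s <= n)%N ->
  exists (e1 e2 e3 : 'M[K]_(n, s)) (d2 d3 : 'rV[K]_n),
  [/\ [/\ e1^T *m e1 = 1%:M, e1^T *m e2 = 0 & e1^T *m e3 = 0],
      [/\ e2^T *m e1 = 0, e2^T *m e2 = 1%:M & e2^T *m e3 = 0],
      [/\ e3^T *m e1 = 0, e3^T *m e2 = 0 & e3^T *m e3 = 1%:M],
      e2 *m e2^T = diag_mx d2 & e3 *m e3^T = diag_mx d3].
Proof.
move=> sn; have [t ->] : exists t, n = (s + (s + (s + t)))%N.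
  by exists (n - 3 * s)%N; lia.
exists (col_mx 1%:M 0), (col_mx 0 (col_mx 1%:M 0)), (col_mx 0 (col_mx 0 (col_mx 1%:M 0))).
exists (row_mx 0 (row_mx (const_mx 1) 0)), (row_mx 0 (row_mx 0 (row_mx (const_mx 1) 0))).
rewrite !tr_col_mx !mul_row_col !(trmx0, trmx1, mul0mx, mulmx0, mul1mx, add0r, addr0).
rewrite !mul_col_row !(trmx0, trmx1, mul0mx, mulmx0, mul1mx).
by rewrite !diag_mx_row !diag_const_mx !raddf0.
Qed.

(* For U^T = V^T = (1 | B), the slices are the matrices D + B G B^T with D, G diagonal. *)
Lemma exists_witness (K : fieldType) (n p r : nat) (i k l m : 'I_p) :
  (n <= r)%N -> (3 * r <= 4 * n)%N -> uniq [:: i; k; l; m] ->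
  exists (U : 'M[K]_(r, n)) (W : 'M[K]_(r, p)),
  let S := slice_of U U W in
  [/\ S i = 1%:M, (2 * (r - n) <= \rank (mxbracket (S k) (S l)))%N
   & (3 * (r - n) <= \rank (row_mx (mxbracket (S k) (S l)) (mxbracket (S k) (S m))))%N].
Proof.
move=> nr rn; have [s rE] : exists s, r = (n + s)%N by exists (r - n)%N; lia.
rewrite rE addKn {nr} => ne; rewrite {r}rE in rn *.
(* With r = n + s, the bound 3r <= 4n is exactly the room 3s <= n for three frames. *)
have [|e1 [e2 [e3 [d2 [d3 [[e11 e12 e13] [e21 e22 e23] [e31 e32 e33] E2 E3]]]]]] :=
  @exists_three_frames K n s; first lia.
pose B := e1 + e2 + e3.
(* A column (d | g) of [W] yields the slice diag d + B diag(g) B^T. The last branch covers [m] and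
   also every index outside the four prescribed ones, where any value would do. *)
pose D (j : 'I_p) : 'rV[K]_(n + s) :=
  if j == i then row_mx (const_mx 1) 0 else if j == k then row_mx 0 (const_mx 1)
  else if j == l then row_mx d2 0 else row_mx d3 0.
exists (col_mx 1%:M B^T), (\matrix_(a, j) D j 0 a) => S.
have SE j d g : D j = row_mx d g -> S j = diag_mx d + B *m diag_mx g *m B^T.
  move=> Dj; rewrite /S /slice_of.
  have -> : (col j (\matrix_(a, j) D j 0 a))^T = row_mx d g.
    by rewrite -Dj; apply/rowP => a; rewrite !mxE.
  rewrite diag_mx_row tr_col_mx trmx1 trmxK mul_row_block mul_row_col.
  by rewrite !mulmx0 mul1mx mulmx1 addr0 add0r.
move: ne; rewrite /= !inE !negb_or => /and4P[/and3P[ik il im] /andP[kl km] lm _].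
have Si : S i = 1%:M.
  rewrite (SE i (const_mx 1) 0) ?/D ?eqxx // diag_const_mx raddf0.
  by rewrite mulmx0 mul0mx addr0.
have Sk : S k = B *m B^T.
  rewrite (SE k 0 (const_mx 1)) ?/D 1?eq_sym ?(negPf ik) ?eqxx //.
  by rewrite raddf0 add0r diag_const_mx mulmx1.
have Sl : S l = e2 *m e2^T.
  rewrite (SE l d2 0) ?E2 ?raddf0 ?mulmx0 ?mul0mx ?addr0 // /D.
  by rewrite !(eq_sym l) (negPf il) (negPf kl) eqxx.
have Sm : S m = e3 *m e3^T.
  rewrite (SE m d3 0) ?E3 ?raddf0 ?mulmx0 ?mul0mx ?addr0 // /D.
  by rewrite !(eq_sym m) (negPf im) (negPf km) (negPf lm).
rewrite Si Sk Sl Sm; split=> //; first exact: rank_witness_bracket.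
exact: rank_witness_brackets.
Qed.

(** * Generic invertibility, and passage from inverses to adjugates *)

Lemma mxbracketZ (K : fieldType) (n : nat) (c : K) (X Y : 'M[K]_n) :
  mxbracket (c *: X) (c *: Y) = (c * c) *: mxbracket X Y.
Proof. by rewrite /mxbracket -!scalemxAl -!scalemxAr !scalerA scalerBr. Qed.

Lemma rank_colspaces (K : fieldType) (n a b : nat) (X : 'M[K]_(n, a)) (Y : 'M[K]_(n, b)) :
  \rank (colspace X + colspace Y)%MS = \rank (row_mx X Y).
Proof.
rewrite -(mxrank_tr (row_mx X Y)) tr_row_mx -addsmxE.
by apply/eqmx_rank/eqmxP/adds_eqmx; exact: genmxE.
Qed.

(** At the point where [U] and [V] are the identity padded by zero rows and [W] is all ones, the
    slice is the identity; the padding requires n <= r. *)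
Lemma generic_slice_unitmx (K : fieldType) (n p r : nat) (k : 'I_p) : (n <= r)%N ->
  generic (fun x : 'rV[K]_(r * (n + n + p)) =>
    slice_of (umx x) (vmx x) (wmx x) k \in unitmx).
Proof.
move=> nr; have [uE vE wE] := @coordsK K n p r (pid_mx n) (pid_mx n) (const_mx 1).
have := generic_rank (d := n) (x0 := coords (pid_mx n) (pid_mx n) (const_mx 1))
  (@polymx_slice_of K n p r k).
rewrite uE vE wE /slice_of.
have -> : (col k (const_mx 1 : 'M[K]_(r, p)))^T = const_mx 1.
  by apply/rowP => a; rewrite !mxE.
rewrite diag_const_mx mulmx1 tr_pid_mx pid_mx_id // pid_mx_1 mxrank1.
by move/(_ (leqnn n)); apply: generic_sub => x; rewrite -row_free_unit -row_leq_rank.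
Qed.

Lemma generic_wdiag_unitmx (K : fieldType) (n p r : nat) (k : 'I_p) :
  generic (fun x : 'rV[K]_(r * (n + n + p)) => diag_mx (col k (wmx x))^T \in unitmx).
Proof.
have [_ _ wE] := @coordsK K n p r 0 0 (const_mx 1).
have := generic_rank (d := r) (x0 := coords 0 0 (const_mx 1))
  (@polymx_wdiag K n p r k).
rewrite wE.
have -> : (col k (const_mx 1 : 'M[K]_(r, p)))^T = const_mx 1.
  by apply/rowP => a; rewrite !mxE.
rewrite diag_const_mx mxrank1.
by move/(_ (leqnn r)); apply: generic_sub => x; rewrite -row_free_unit -row_leq_rank.
Qed.

Lemma comm_mx_invmx (K : fieldType) (n : nat) (D E : 'M[K]_n) :
  D \in unitmx -> comm_mx D E -> comm_mx (invmx D) E.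
Proof.
move=> uD DE; rewrite /comm_mx -{1}(mulmxK uD E) -DE !mulmxA mulVmx //.
by rewrite mul1mx.
Qed.

Section Ranks.
Variables (K : fieldType) (n p r : nat) (U V : 'M[K]_(r, n)) (W : 'M[K]_(r, p)).
Variable i : 'I_p.
Let S := slice_of U V W.
Let A k := invmx (S i) *m S k.
Hypothesis Si : S i \in unitmx.

(** The left side is polynomial in the coordinates, unlike [A k]. The factor is a nonzero scalar, so
    brackets change only by its square and ranks are preserved. *)
Lemma adj_slice k : \adj (S i) *m S k = \det (S i) *: A k.
Proof.
rewrite /A /invmx Si -scalemxAl scalerA divrr -?unitmxE //.
by rewrite scale1r.
Qed.

Lemma rank_bracket_adj k l :
  \rank (mxbracket (\adj (S i) *m S k) (\adj (S i) *m S l)) =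
  \rank (mxbracket (A k) (A l)).
Proof.
rewrite !adj_slice mxbracketZ mxrank_scale_nz //.
by rewrite mulf_neq0 // -unitfE -unitmxE.
Qed.

Lemma rank_brackets_adj k l m :
  \rank (row_mx (mxbracket (\adj (S i) *m S k) (\adj (S i) *m S l))
                (mxbracket (\adj (S i) *m S k) (\adj (S i) *m S m))) =
  \rank (colspace (mxbracket (A k) (A l)) + colspace (mxbracket (A k) (A m)))%MS.
Proof.
rewrite !adj_slice !mxbracketZ -scale_row_mx mxrank_scale_nz ?rank_colspaces //.
by rewrite mulf_neq0 // -unitfE -unitmxE.
Qed.

Hypothesis Di : diag_mx (col i W)^T \in unitmx.

Let D j := diag_mx (col j W)^T.
Let L := invmx (S i) *m U^T *m D i.
Let E j := invmx (D i) *m D j.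

Let LV : L *m V = 1%:M.
(* L V is S_i^-1 times U^T D_i V, which is [S i] itself. *)
Proof. by rewrite /L -2!mulmxA (mulmxA _ (D i)) mulVmx. Qed.

Let AE k : A k = L *m E k *m V.
Proof. by rewrite /L /E !mulmxA mulmxK // /A /S /slice_of !mulmxA. Qed.

Let commE k l : comm_mx (E k) (E l).
Proof.
have commD j : comm_mx (E k) (D j).
  apply: comm_mx_sym; apply: comm_mxM (diag_mx_comm _ _).
  by apply/comm_mx_sym/comm_mx_invmx => //; exact: diag_mx_comm.
by apply: comm_mxM => //; apply/comm_mx_sym/comm_mx_invmx/comm_mx_sym.
Qed.

Lemma rank_bracket_le k l : (\rank (mxbracket (A k) (A l)) <= 2 * (r - n))%N.
Proof. by rewrite !AE rank_bracket_compression. Qed.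

Lemma rank_brackets_le k l m :
  (\rank (colspace (mxbracket (A k) (A l)) + colspace (mxbracket (A k) (A m)))%MS
    <= 3 * (r - n))%N.
Proof. by rewrite !AE rank_brackets_compression. Qed.

End Ranks.

(** At the witness [S i] is the identity, hence so is its adjugate, and the matrices [C] reduce to
    the slices there. *)
Lemma generic_rank_brackets_ge (K : fieldType) (n p r : nat) (i k l m : 'I_p) :
  (n <= r)%N -> (3 * r <= 4 * n)%N -> uniq [:: i; k; l; m] ->
  generic (fun x : 'rV[K]_(r * (n + n + p)) =>
    let C k := \adj (slice_of (umx x) (vmx x) (wmx x) i) *m
               slice_of (umx x) (vmx x) (wmx x) k in
    (2 * (r - n) <= \rank (mxbracket (C k) (C l)))%N /\
    (3 * (r - n) <= \rank (row_mx (mxbracket (C k) (C l)) (mxbracket (C k) (C m))))%N).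
Proof.
move=> nr rn ne; have [U [W [Si Skl Sklm]]] := exists_witness K nr rn ne.
have pC j : polymx (fun x : 'rV[K]_(r * (n + n + p)) =>
    \adj (slice_of (umx x) (vmx x) (wmx x) i) *m slice_of (umx x) (vmx x) (wmx x) j).
  by apply: polymx_mul; [apply: polymx_adj|]; exact: polymx_slice_of.
have [uE vE wE] := coordsK U U W.
apply: generic_and.
  apply: (generic_rank (x0 := coords U U W)); first exact: polymx_bracket.
  by rewrite uE vE wE Si adj1 !mul1mx.
apply: (generic_rank (x0 := coords U U W)).
  by apply: polymx_row; exact: polymx_bracket.
by rewrite uE vE wE Si adj1 !mul1mx.
Qed.

(* Slices are indexed from 0: the slice of index k is T_(k+1), so A k below,
   for 0 < k < p, is the matrix A_k = T_1^-1 T_(k+1). *)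
Theorem theorem6p3 (K : fieldType) (Kinf : infinite_type K) (n p r : nat)
    (n_gt0 : (0 < n)%N) (p_gt0 : (0 < p)%N) (r_gt0 : (0 < r)%N) :
  generic (fun x : 'rV[K]_(r * (n + n + p)) =>
    let T : tensor K n n p :=
      \sum_(i < r) otimes (uvec x i) (vvec x i) (wvec x i) in
    let A (k : 'I_p) : 'M[K]_n :=
      invmx (slice T (Ordinal p_gt0)) *m slice T k in
    ((n <= r)%N -> forall k : 'I_p, slice T k \in unitmx) /\
    ((4 <= p)%N -> (n <= r)%N -> (3 * r <= 4 * n)%N ->
      forall k l m : 'I_p, (0 < k)%N -> (0 < l)%N -> (0 < m)%N ->
        k != l -> k != m -> l != m ->
        \rank (mxbracket (A k) (A l)) = (2 * (r - n))%N /\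
        \rank (colspace (mxbracket (A k) (A l)) +
               colspace (mxbracket (A k) (A m)))%MS = (3 * (r - n))%N)).
Proof.
(* Both claims assume n <= r, so they are vacuous otherwise. *)
case: (leqP n r) => [nr|_]; last exact: generic_true.
set i := Ordinal p_gt0.
pose Q (t : 'I_p * 'I_p * 'I_p) (x : 'rV[K]_(r * (n + n + p))) :=
  let C k := \adj (slice_of (umx x) (vmx x) (wmx x) i) *m
             slice_of (umx x) (vmx x) (wmx x) k in
  (2 * (r - n) <= \rank (mxbracket (C t.1.1) (C t.1.2)))%N /\
  (3 * (r - n) <= \rank (row_mx (mxbracket (C t.1.1) (C t.1.2))
                                (mxbracket (C t.1.1) (C t.2))))%N.
(* There are finitely many triples, so a single polynomial handles them all. *)
have genQ : generic (fun x => forall t,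
    (3 * r <= 4 * n)%N && uniq [:: i; t.1.1; t.1.2; t.2] -> Q t x).
  apply: generic_all => t; apply: generic_imply => /andP[rn ne].
  exact: generic_rank_brackets_ge.
have genS := generic_all (fun k => @generic_slice_unitmx K n p r k nr).
apply: generic_sub (generic_and (generic_and genS genQ)
  (@generic_wdiag_unitmx K n p r i)) => x [[uS Qx] uD] /=.
split=> [_ k|_ _ rn k l m k0 l0 m0 kl km lm]; first by rewrite slice_sum_otimes.
have [|Qkl Qklm] := Qx (k, l, m).
  rewrite rn /= !inE !negb_or kl km lm !andbT /=.
  (* Positivity of the three indices says that they differ from [i], whose value is 0. *)
  by rewrite -!val_eqE /= !(eq_sym 0%N) -!lt0n k0 l0 m0.
rewrite !slice_sum_otimes.
(* The upper bounds come from the compression, the lower ones from the adjugate form. *)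
split; apply/eqP; rewrite eqn_leq.
  by rewrite rank_bracket_le // -rank_bracket_adj.
by rewrite rank_brackets_le // -rank_brackets_adj.
Qed.
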